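(* Let $c>0$, $g\in C^2([0,\infty))$, $h\in C^1([0,\infty))$, $f\in C^1([0,\infty))$, and let $u: D^+\cup D^-\to\mathbb{R}$ be the solution (given by the explicit formula in the context) of the Neumann problem $$u_{tt}-c^2u_{xx}=0\ (x>0,t>0),\quad u(x,0)=g(x),\ u_t(x,0)=h(x)\ (x>0),\quad u_x(0,t)=f(t)\ (t>0).$$ Then $u$ is continuous across the characteristic line $t=x/c$, without any compatibility condition on the initial and boundary data.
   Context: Domains: $D^+=\{(x,t): x>0,\ t>0,\ x>ct\}$ and $D^-=\{(x,t): t>0,\ 0<x<ct\}$, separated by the characteristic line $x=ct$. The solution of the Neumann problem means the function obtained from d'Alembert's formula: $$u(x,t)=\tfrac12[g(x+ct)+g(x-ct)]+\tfrac1{2c}\int_{x-ct}^{x+ct}h(\xi)\,d\xi,\quad (x,t)\in D^+,$$ $$u(x,t)=\tfrac12[g(x+ct)+g(ct-x)]+\tfrac1{2c}\Big[\int_0^{x+ct}h(\xi)\,d\xi+\int_0^{ct-x}h(\xi)\,d\xi\Big]-c\int_0^{t-x/c}f(\xi)\,d\xi,\quad (x,t)\in D^-.$$ For a function $w$ on $D^+\cup D^-$, the jump at a point $(x_0,x_0/c)$, $x_0>0$, is $[w]_{t=x/c}=\lim_{D^-\ni(x,t)\to(x_0,x_0/c)}w(x,t)-\lim_{D^+\ni(x,t)\to(x_0,x_0/c)}w(x,t)$ (both limits existing). $w$ is continuous across the line if this jump is zero at every such point. *)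

(* Defs.v *)
From Stdlib Require Import Reals.
From Coquelicot Require Import Coquelicot.
Open Scope R_scope.

(** Points [(x, t)] of the plane have type [R * R].  A function on the half-line
    [[0, +oo)], or on [Dplus c] union [Dminus c], is a total function of which
    only the values there are used. *)

Definition Dplus (c : R) (p : R * R) : Prop :=
  0 < fst p /\ 0 < snd p /\ c * snd p < fst p.

Definition Dminus (c : R) (p : R * R) : Prop :=
  0 < snd p /\ 0 < fst p < c * snd p.

(** The class C^k([0, +oo)).  Restricting the neighbourhood filter to [[0, +oo)]
    makes continuity and differentiability one-sided at [0] and leaves them
    unchanged at every [x > 0]. *)
Fixpoint Ck_half_line (k : nat) (g : R -> R) : Prop :=
  match k with
  | O => forall x : R, 0 <= x ->
      filterlim g (within (Rle 0) (locally x)) (locally (g x))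
  | S k' => exists g' : R -> R,
      (forall x : R, 0 <= x ->
         filterdiff g (within (Rle 0) (locally x)) (fun y : R => scal y (g' x)))
      /\ Ck_half_line k' g'
  end.

(** The solution of the Neumann problem
      u_tt - c^2 u_xx = 0 (x, t > 0),  u(x,0) = g(x),  u_t(x,0) = h(x),
      u_x(0,t) = f(t)
    is by definition the function on [Dplus c] union [Dminus c] obtained from
    d'Alembert's formula; nothing is prescribed on the line [x = c t]. *)
Definition neumann_solution (c : R) (g h f : R -> R) (u : R * R -> R) : Prop :=
  (forall x t : R, Dplus c (x, t) ->
     u (x, t) = 1 / 2 * (g (x + c * t) + g (x - c * t))
                + 1 / (2 * c) * RInt h (x - c * t) (x + c * t))
  /\
  (forall x t : R, Dminus c (x, t) ->
     u (x, t) = 1 / 2 * (g (x + c * t) + g (c * t - x))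
                + 1 / (2 * c) * (RInt h 0 (x + c * t) + RInt h 0 (c * t - x))
                - c * RInt f 0 (t - x / c)).

(** [j] is the jump of [w] at [(x0, x0 / c)]: the limit from [Dminus c] minus the
    limit from [Dplus c], both required to exist and to be finite. *)
Definition is_jump (c : R) (w : R * R -> R) (x0 j : R) : Prop :=
  exists lm lp : R,
    filterlim w (within (Dminus c) (locally (x0, x0 / c))) (locally lm)
    /\ filterlim w (within (Dplus c) (locally (x0, x0 / c))) (locally lp)
    /\ j = lm - lp.

Definition continuous_across (c : R) (w : R * R -> R) : Prop :=
  forall x0 : R, 0 < x0 -> is_jump c w x0 0.

(* Main.v *)
Require Import Defs.
From Stdlib Require Import Reals Lra.
From Coquelicot Require Import Coquelicot.
Open Scope R_scope.

(** Extend [g], [h], [f] evenly to the whole line, and let [H] and [F] be the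
    primitives of the extended [h] and [f] that vanish at [0]; [H] is odd.  For
    even extended data d'Alembert's function
      [P (x, t) = (g (x+ct) + g (x-ct)) / 2 + (H (x+ct) - H (x-ct)) / (2c)]
    is continuous on the whole plane.  On [Dplus c] it is [u].  On [Dminus c],
    where [x - c t] is negative, evenness of [g] and oddness of [H] turn the
    terms of [u] in [c t - x] into those of [P], so that
      [u (x, t) = P (x, t) - c F (t - x / c)].
    The two one-sided limits of [u] at [(x0, x0 / c)] are thus values of
    continuous functions, and they differ by [c F 0 = 0].  The data need not
    match at the corner: the boundary datum enters only through its primitive
    [F], and an even extension is continuous whatever the datum is. *)

Lemma Ck_half_line_continuous (k : nat) (g : R -> R) :
  Ck_half_line k g -> Ck_half_line 0 g.
Proof.
  destruct k as [|k]; [easy|].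
  intros [g' [Hg _]] x Hx.
  apply (filterdiff_continuous_aux (F := within (Rle 0) (locally x)) g).
  - exists (fun y : R => scal y (g' x)). now apply Hg.
  - intros P HP. now apply filter_le_within.
Qed.

(** The even extension is continuous also at [0], because the folding [Rabs]
    takes its values in the half-line. *)
Lemma continuous_even_extension (g : R -> R) (y : R) :
  Ck_half_line 0 g -> continuous (fun z => g (Rabs z)) y.
Proof.
  intros Hg.
  apply (filterlim_comp _ _ _ Rabs g _ (within (Rle 0) (locally (Rabs y)))).
  - intros P HP. unfold filtermap.
    apply (filter_imp (fun z => 0 <= Rabs z -> P (Rabs z))).
    + intros z Hz. apply Hz, Rabs_pos.
    + exact (continuous_Rabs y _ HP).
  - apply Hg, Rabs_pos.
Qed.

Definition even_primitive (h : R -> R) (y : R) : R :=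
  RInt (fun z => h (Rabs z)) 0 y.

Lemma ex_RInt_even_extension (h : R -> R) (a b : R) :
  Ck_half_line 0 h -> ex_RInt (fun z => h (Rabs z)) a b.
Proof.
  intros Hh.
  apply (ex_RInt_continuous (V := R_CompleteNormedModule)).
  intros z _. now apply continuous_even_extension.
Qed.

Lemma continuous_even_primitive (h : R -> R) (y : R) :
  Ck_half_line 0 h -> continuous (even_primitive h) y.
Proof.
  intros Hh.
  apply (continuous_RInt_1 (fun z => h (Rabs z)) 0 y).
  apply filter_forall. intros z.
  apply (RInt_correct (fun z => h (Rabs z)) 0 z).
  now apply ex_RInt_even_extension.
Qed.

Lemma even_primitive_opp (h : R -> R) (y : R) :
  Ck_half_line 0 h -> even_primitive h (- y) = - even_primitive h y.
Proof.
  intros Hh.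
  apply is_RInt_unique.
  apply (is_RInt_ext (fun z => opp (opp (h (Rabs (- z)))))).
  - intros z _. rewrite opp_opp. now rewrite Rabs_Ropp.
  - apply (is_RInt_opp (fun z => opp (h (Rabs (- z))))).
    apply (is_RInt_comp_opp (fun z => h (Rabs z))).
    rewrite Ropp_0, Ropp_involutive.
    apply (RInt_correct (fun z => h (Rabs z)) 0 y).
    now apply ex_RInt_even_extension.
Qed.

Lemma RInt_even_primitive (h : R -> R) (a b : R) :
  Ck_half_line 0 h -> 0 <= a -> 0 <= b ->
  RInt h a b = even_primitive h b - even_primitive h a.
Proof.
  intros Hh Ha Hb.
  assert (E : even_primitive h a + RInt h a b = even_primitive h b); [|lra].
  rewrite (RInt_ext h (fun z => h (Rabs z)) a b).
  - apply (RInt_Chasles (fun z => h (Rabs z)) 0 a b);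
      now apply ex_RInt_even_extension.
  - intros z [Hz _]. rewrite Rabs_pos_eq; [easy|].
    apply Rle_trans with (2 := Rlt_le _ _ Hz). now apply Rmin_glb.
Qed.

Lemma even_primitive_0 (h : R -> R) : even_primitive h 0 = 0.
Proof. apply (RInt_point (V := R_CompleteNormedModule)). Qed.

Definition dAlembert_even (c : R) (g h : R -> R) (p : R * R) : R :=
  1 / 2 * (g (Rabs (fst p + c * snd p)) + g (Rabs (fst p - c * snd p)))
  + 1 / (2 * c) * (even_primitive h (fst p + c * snd p)
                   - even_primitive h (fst p - c * snd p)).

Lemma continuous_linear_form (a b : R) (p : R * R) :
  continuous (fun q : R * R => a * fst q + b * snd q) p.
Proof.
  apply (continuous_plus (fun q : R * R => a * fst q) (fun q => b * snd q)).
  - apply (continuous_scal_r a (fun q : R * R => fst q)), continuous_fst.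
  - apply (continuous_scal_r b (fun q : R * R => snd q)), continuous_snd.
Qed.

(** The form is given up to an equation so that [x - c * t] and [t - x / c]
    also fit. *)
Lemma continuous_comp_linear_form (phi : R -> R) (l : R * R -> R) (a b : R) :
  (forall y, continuous phi y) ->
  (forall q, l q = a * fst q + b * snd q) ->
  forall p, continuous (fun q => phi (l q)) p.
Proof.
  intros Hphi Hl p.
  apply (continuous_comp l phi); [|apply Hphi].
  apply (continuous_ext (fun q : R * R => a * fst q + b * snd q)).
  - intros q. now rewrite Hl.
  - apply continuous_linear_form.
Qed.

Lemma continuous_dAlembert_even (c : R) (g h : R -> R) (p : R * R) :
  Ck_half_line 0 g -> Ck_half_line 0 h ->
  continuous (dAlembert_even c g h) p.
Proof.
  intros Hg Hh.
  assert (Hplus : forall phi : R -> R, (forall y, continuous phi y) ->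
            continuous (fun q : R * R => phi (fst q + c * snd q)) p).
  { intros phi Hphi.
    apply (continuous_comp_linear_form phi _ 1 c Hphi). intros q; ring. }
  assert (Hminus : forall phi : R -> R, (forall y, continuous phi y) ->
            continuous (fun q : R * R => phi (fst q - c * snd q)) p).
  { intros phi Hphi.
    apply (continuous_comp_linear_form phi _ 1 (- c) Hphi). intros q; ring. }
  assert (HG : forall y, continuous (fun z => g (Rabs z)) y)
    by (intros y; now apply continuous_even_extension).
  assert (HH : forall y, continuous (even_primitive h) y)
    by (intros y; now apply continuous_even_primitive).
  apply (continuous_plus
    (fun q : R * R =>
       1 / 2 * (g (Rabs (fst q + c * snd q)) + g (Rabs (fst q - c * snd q))))
    (fun q => 1 / (2 * c) * (even_primitive h (fst q + c * snd q)
                             - even_primitive h (fst q - c * snd q)))).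
  - apply (continuous_scal_r (1 / 2) (fun q : R * R =>
      g (Rabs (fst q + c * snd q)) + g (Rabs (fst q - c * snd q)))).
    apply (continuous_plus (fun q : R * R => g (Rabs (fst q + c * snd q)))
                           (fun q => g (Rabs (fst q - c * snd q)))).
    + apply (Hplus _ HG).
    + apply (Hminus _ HG).
  - apply (continuous_scal_r (1 / (2 * c)) (fun q : R * R =>
      even_primitive h (fst q + c * snd q)
      - even_primitive h (fst q - c * snd q))).
    apply (continuous_minus
             (fun q : R * R => even_primitive h (fst q + c * snd q))
             (fun q => even_primitive h (fst q - c * snd q))).
    + apply (Hplus _ HH).
    + apply (Hminus _ HH).
Qed.

Lemma neumann_solution_Dplus (c : R) (g h f : R -> R) (u : R * R -> R) :
  0 < c -> Ck_half_line 0 h -> neumann_solution c g h f u ->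
  forall p, Dplus c p -> u p = dAlembert_even c g h p.
Proof.
  intros Hc Hh [Hu _] [x t] Hp. rewrite (Hu x t Hp).
  destruct Hp as [Hx [Ht Hxt]]; simpl in Hx, Ht, Hxt.
  assert (0 < c * t) by now apply Rmult_lt_0_compat.
  unfold dAlembert_even; simpl.
  rewrite RInt_even_primitive by (assumption || lra).
  now rewrite !Rabs_pos_eq by lra.
Qed.

(** Reflection at the boundary: [c t - x] is the mirror image of [x - c t], so the
    reflected terms are those of the evenly extended data. *)
Lemma neumann_solution_Dminus (c : R) (g h f : R -> R) (u : R * R -> R) :
  0 < c -> Ck_half_line 0 h -> Ck_half_line 0 f ->
  neumann_solution c g h f u ->
  forall p, Defs.Dminus c p ->
  u p = dAlembert_even c g h p - c * even_primitive f (snd p - fst p / c).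
Proof.
  intros Hc Hh Hf [_ Hu] [x t] Hp. rewrite (Hu x t Hp).
  destruct Hp as [Ht [Hx Hxt]]; simpl in Ht, Hx, Hxt.
  assert (Htx : 0 < t - x / c).
  { replace (t - x / c) with ((c * t - x) / c) by (field; lra).
    apply Rdiv_lt_0_compat; lra. }
  unfold dAlembert_even; simpl.
  rewrite !RInt_even_primitive by (assumption || lra).
  rewrite !even_primitive_0.
  replace (c * t - x) with (- (x - c * t)) by ring.
  rewrite even_primitive_opp by assumption.
  rewrite (Rabs_pos_eq (x + c * t)), (Rabs_left (x - c * t)) by lra.
  field; lra.
Qed.

Lemma filterlim_within_of_eq (D : R * R -> Prop) (u v : R * R -> R) (p : R * R) :
  (forall q, D q -> u q = v q) -> continuous v p ->
  filterlim u (within D (locally p)) (locally (v p)).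
Proof.
  intros Huv Hv.
  apply (filterlim_within_ext (F := locally p) D v u).
  - intros q Hq. now rewrite Huv.
  - apply (filterlim_filter_le_1 (F := locally p));
      [apply filter_le_within | exact Hv].
Qed.

Theorem proposition3 (c : R) (g h f : R -> R) (u : R * R -> R)
  (hc : 0 < c)
  (hg : Ck_half_line 2 g) (hh : Ck_half_line 1 h) (hf : Ck_half_line 1 f)
  (hu : neumann_solution c g h f u) :
  continuous_across c u.
Proof.
  apply Ck_half_line_continuous in hg, hh, hf.
  intros x0 _.
  set (p0 := (x0, x0 / c)).
  set (Q := fun p : R * R =>
    dAlembert_even c g h p - c * even_primitive f (snd p - fst p / c)).
  exists (Q p0), (dAlembert_even c g h p0). split; [|split].
  - apply filterlim_within_of_eq.
    + intros p Hp.
      now apply (neumann_solution_Dminus c g h f u hc hh hf hu).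
    + apply (continuous_minus (dAlembert_even c g h)
        (fun p : R * R => c * even_primitive f (snd p - fst p / c))).
      * now apply continuous_dAlembert_even.
      * apply (continuous_scal_r c
          (fun p : R * R => even_primitive f (snd p - fst p / c))).
        apply (continuous_comp_linear_form (even_primitive f) _ (- / c) 1).
        -- intros y. now apply continuous_even_primitive.
        -- intros q. field. lra.
  - apply filterlim_within_of_eq.
    + intros p Hp. now apply (neumann_solution_Dplus c g h f u hc hh hu).
    + now apply continuous_dAlembert_even.
  - unfold Q, p0; simpl. rewrite Rminus_diag, even_primitive_0. ring.
Qed.
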